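(* There is an absolute constant $C>0$ such that for every prime $p\geq 3$ and all functions $f,g:\mathbb{Z}/p\mathbb{Z}\to\mathbb{R}$ with $\Vert f\Vert_2\leq 1$ and $\Vert g\Vert_2\leq 1$, there is some $x\in\mathbb{Z}/p\mathbb{Z}$ such that \[ \left| f\ast g(x)-\mathbb{E} f\,\mathbb{E} g\right| \;\leq\; C\left(\frac{\log\log p}{\log p}\right)^{1/3}. \]
   Context: For functions on $\mathbb{Z}/p\mathbb{Z}$: $\mathbb{E} f:=\frac1p\sum_{x} f(x)$; $\Vert f\Vert_2:=\left(\frac1p\sum_x |f(x)|^2\right)^{1/2}$; and $f\ast g(x):=\frac1p\sum_{y\in\mathbb{Z}/p\mathbb{Z}} f(y)g(x-y)$. *)

(* Defs.v *)
From HB Require Import structures.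
From mathcomp Require Import all_boot all_order all_algebra.
From mathcomp Require Import all_classical all_reals all_analysis.
Set Implicit Arguments.
Unset Strict Implicit.
Unset Printing Implicit Defensive.
Import Order.TTheory GRing.Theory Num.Theory.
Local Open Scope ring_scope.

(* The prime field 'F_p has exactly p elements only when p is prime; for other
   p it is Z/qZ with q the least prime factor of p (or 2). These definitions
   are therefore meaningful only for prime p. *)

Definition Emean (R : realType) (p : nat) (f : 'F_p -> R) : R :=
  p%:R^-1 * \sum_(x : 'F_p) f x.

Definition norm2 (R : realType) (p : nat) (f : 'F_p -> R) : R :=
  Num.sqrt (p%:R^-1 * \sum_(x : 'F_p) `|f x| ^+ 2).

Definition convolution (R : realType) (p : nat) (f g : 'F_p -> R) (x : 'F_p) : R :=
  p%:R^-1 * \sum_(y : 'F_p) f y * g (x - y).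

(* Main.v *)
Require Import Defs.
From mathcomp Require Import all_boot all_order all_algebra.
From mathcomp Require Import all_classical all_reals all_analysis.
From mathcomp Require Import fintype finset complex ring lra.
Import Order.TTheory GRing.Theory Num.Theory.
Local Open Scope ring_scope.
Set Implicit Arguments.
Unset Strict Implicit.
Unset Printing Implicit Defensive.

(** Write [h = f * g - E f E g] as a trigonometric polynomial with coefficients
    of total weight at most 1 and no constant term, and suppose [|h| > 1 / n]
    everywhere. On a regular Bohr set [B], split the frequencies into those that
    are almost constant on [B] and the others. If the others contribute little
    to [h] in mean square on every translate of [B], then the means of [h] over
    the translates are bounded away from 0 and vary slowly, so they all have the
    same sign, which is absurd because they average to 0. Otherwise, expanding
    the square on a bad translate yields many weighted pairs of frequencies
    close to each other on a slightly smaller Bohr set; adding [O(n ^ 2)]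
    representatives of the popular clusters to the defining frequencies makes
    an additional weight of at least [1 / (16 n)] almost constant. This can
    happen at most [16 n] times, while the Bohr sets keep a nonzero element as
    long as [p] exceeds [n ^ (O(n ^ 3))]. *)

(** * Real-valued modulus of complex numbers *)

Section Modulus.
Variable R : realType.
Implicit Types (z w : R[i]) (x : R).

(** The norm of [R[i]] takes its values in [R[i]]; this copy lands in [R], where estimates can be
    ordered and added as real numbers. *)
Definition modc z : R := Num.sqrt (complex.Re z ^+ 2 + complex.Im z ^+ 2).

Lemma modcE z : (modc z)%:C%C = `|z|.
Proof. by rewrite normc_def. Qed.

Lemma modc_ge0 z : 0 <= modc z.
Proof. exact: sqrtr_ge0. Qed.

Lemma modcM z w : modc (z * w) = modc z * modc w.
Proof. by apply: complexI; rewrite rmorphM /= !modcE normrM. Qed.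

Lemma modcD z w : modc (z + w) <= modc z + modc w.
Proof. by rewrite -lecR rmorphD /= !modcE ler_normD. Qed.

Lemma modcN z : modc (- z) = modc z.
Proof. by apply: complexI; rewrite /= !modcE normrN. Qed.

Lemma modcB z w : modc (z - w) <= modc z + modc w.
Proof. by rewrite -[modc w]modcN modcD. Qed.

Lemma modcBC z w : modc (z - w) = modc (w - z).
Proof. by rewrite -modcN opprB. Qed.

Lemma modc_real x : modc x%:C%C = `|x|.
Proof. by rewrite /modc /= expr0n /= addr0 sqrtr_sqr. Qed.

Lemma modc0 : modc 0 = 0.
Proof. by have := modc_real 0; rewrite normr0. Qed.

Lemma modc1 : modc 1 = 1.
Proof. by have := modc_real 1; rewrite normr1. Qed.

Lemma modc_conj z : modc z^*%C = modc z.
Proof. by apply: complexI; rewrite /= !modcE normcJ. Qed.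

Lemma sqr_modc z : ((modc z) ^+ 2)%:C%C = z * z^*%C.
Proof. by rewrite rmorphXn /= modcE sqr_normc. Qed.

Lemma modc_sum (I : Type) (r : seq I) (P : pred I) (F : I -> R[i]) :
  modc (\sum_(i <- r | P i) F i) <= \sum_(i <- r | P i) modc (F i).
Proof.
elim/big_ind2: _ => [|z a w b za wb|//]; first by rewrite modc0.
exact: le_trans (modcD _ _) (lerD za wb).
Qed.

Lemma Re_le_modc z : `|complex.Re z| <= modc z.
Proof. by rewrite -sqrtr_sqr ler_wsqrtr// lerDl sqr_ge0. Qed.

Lemma Im_le_modc z : `|complex.Im z| <= modc z.
Proof. by rewrite -sqrtr_sqr ler_wsqrtr// lerDr sqr_ge0. Qed.

Lemma modc_le_cell z (rho : R) :
  `|complex.Re z| <= rho / 2 -> `|complex.Im z| <= rho / 2 -> modc z <= rho.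
Proof.
move=> zr zi; have rho0 : 0 <= rho by have := normr_ge0 (complex.Re z); lra.
rewrite -[leRHS]ger0_norm// -sqrtr_sqr ler_wsqrtr//.
have sq (a : R) : `|a| <= rho / 2 -> a ^+ 2 <= (rho / 2) ^+ 2.
  by move=> ha; rewrite -[a ^+ 2]real_normK ?num_real// lerXn2r ?nnegrE//; lra.
apply: le_trans (lerD (sq _ zr) (sq _ zi)) _.
by rewrite [leRHS](_ : _ = 4 * (rho / 2) ^+ 2); [have := sqr_ge0 (rho / 2); lra|field].
Qed.

End Modulus.

Lemma bernoulli_ineq (R : realDomainType) (x : R) n :
  0 <= x -> 1 + n%:R * x <= (1 + x) ^+ n.
Proof.
move=> x0; elim: n => [|n IH]; first by rewrite mul0r addr0.
rewrite exprS; apply: (@le_trans _ _ ((1 + x) * (1 + n%:R * x))); last first.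
  by apply: ler_wpM2l => //; rewrite addr_ge0.
have : 0 <= n%:R * x * x by rewrite !mulr_ge0.
by rewrite -natr1 !mulrDl !mulrDr !mulr1 !mul1r; lra.
Qed.

(** * Bohr sets: covering, nonzero elements, regular radii *)

Section Bohr.
Variables (R : realType) (p : nat) (u : 'F_p -> R[i]).
Hypotheses (uD : {morph u : x y / x + y >-> x * y})
           (u_mod : forall x, modc (u x) = 1).
Implicit Types (x y t q : 'F_p) (G H : {set 'F_p}) (rho sigma : R).

Lemma char_neq0 x : u x != 0.
Proof. by apply/eqP => ux; have := u_mod x; rewrite ux modc0; lra. Qed.

Lemma char0 : u 0 = 1.
Proof. by apply: (mulfI (char_neq0 0)); rewrite -uD addr0 mulr1. Qed.

Lemma charN x : u (- x) = (u x)^*%C.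
Proof.
apply: (mulfI (char_neq0 x)).
by rewrite -uD subrr char0 -sqr_modc u_mod expr1n.
Qed.

Lemma char_distB x y : modc (1 - u (x - y)) = modc (u y - u x).
Proof.
rewrite -[RHS]mul1r -(u_mod (- y)) -modcM mulrBr -!uD addNr char0.
by rewrite [- y + x]addrC.
Qed.

Lemma char_distN x : modc (1 - u (- x)) = modc (1 - u x).
Proof. by rewrite -[- x]sub0r char_distB char0 modcBC. Qed.

Lemma char_distD x y :
  modc (1 - u (x + y)) <= modc (1 - u x) + modc (1 - u y).
Proof.
have -> : 1 - u (x + y) = (1 - u x) + u x * (1 - u y) by rewrite uD; ring.
by apply: le_trans (modcD _ _) _; rewrite modcM u_mod mul1r.
Qed.

Lemma char_dist_le2 x : modc (1 - u x) <= 2.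
Proof. by apply: le_trans (modcB _ _) _; rewrite u_mod modc1; lra. Qed.

(** Closeness is measured by the chord [|1 - u (q t)|] instead of an angle, so radius 2 gives the
    whole group. *)
Definition bohr G rho : {set 'F_p} :=
  [set t | [forall q in G, modc (1 - u (q * t)) <= rho]].

Lemma bohrP G rho t :
  reflect (forall q, q \in G -> modc (1 - u (q * t)) <= rho) (t \in bohr G rho).
Proof. by rewrite inE; apply: (iffP forall_inP). Qed.

Lemma bohrS G H rho sigma :
  G \subset H -> sigma <= rho -> bohr H sigma \subset bohr G rho.
Proof.
move=> /subsetP GH sr; apply/subsetP => t /bohrP tH; apply/bohrP => q /GH qH.
exact: le_trans (tH q qH) sr.
Qed.

Lemma bohrD G rho sigma t x :
  t \in bohr G rho -> x \in bohr G sigma -> t + x \in bohr G (rho + sigma).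
Proof.
move=> /bohrP tG /bohrP xG; apply/bohrP => q qG.
by rewrite mulrDr (le_trans (char_distD _ _))// lerD ?tG ?xG.
Qed.

Lemma bohr0 G rho : 0 <= rho -> 0 \in bohr G rho.
Proof. by move=> r0; apply/bohrP => q _; rewrite mulr0 char0 subrr modc0. Qed.

Lemma card_bohr_gt0 G rho : 0 <= rho -> (0 < #|bohr G rho|)%N.
Proof. by move=> r0; apply/card_gt0P; exists 0; apply: bohr0. Qed.

(* Split the square of side [2 sigma] around 1 into [m.+1 ^ 2] square cells of
   side at most [rho / 2]; two points of [bohr G sigma] whose characters lie in
   the same cells differ by an element of [bohr G rho]. *)
Lemma card_bohr_cover G rho sigma m : 0 < rho -> 4 * sigma < m.+1%:R * rho ->
  (#|bohr G sigma| <= (m.+1 ^ 2) ^ #|G| * #|bohr G rho|)%N.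
Proof.
move=> rho0 sm.
(* Cells have width [rho / 2]. The default of [inord] is never reached: for [|a| <= sigma] the
   argument is at most [4 sigma / rho < m.+1]. *)
pose cell1 (a : R) : 'I_m.+1 := inord (Num.truncn ((a + sigma) * (2 / rho))).
have cell1P (a b : R) : `|a| <= sigma -> `|b| <= sigma ->
    cell1 a = cell1 b -> `|a - b| <= rho / 2.
  have rng (c : R) : `|c| <= sigma ->
      0 <= (c + sigma) * (2 / rho) < m.+1%:R.
    move=> /ler_normlP[c1 c2]; apply/andP; split.
      by rewrite mulr_ge0 ?divr_ge0 ?(ltW rho0)//; lra.
    rewrite mulrA ltr_pdivrMr//; apply: le_lt_trans sm; lra.
  move=> /rng ha /rng hb /(congr1 val); rewrite /= !inordK; first last.
  - by rewrite ltnS truncn_le_nat; case/andP: ha.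
  - by rewrite ltnS truncn_le_nat; case/andP: hb.
  move=> e; have /andP[a0 _] := ha; have /andP[b0 _] := hb.
  have /andP[] := truncn_itv a0; have /andP[] := truncn_itv b0.
  rewrite e; set k := Num.truncn _; rewrite -(natr1 k) => h1 h2 h3 h4.
  have d : `|(a - b) * (2 / rho)| <= 1.
    have -> : (a - b) * (2 / rho) = (a + sigma) * (2 / rho) - (b + sigma) * (2 / rho)
      by ring.
    by rewrite ler_norml; lra.
  rewrite normrM (@ger0_norm _ (2 / rho)) ?divr_ge0 ?(ltW rho0)// in d.
  by rewrite mulrA ler_pdivrMr// mul1r in d; rewrite ler_pdivlMr.
pose cell t : {ffun {q | q \in G} -> 'I_m.+1 * 'I_m.+1} :=
  [ffun q => (cell1 (complex.Re (1 - u (val q * t))),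
              cell1 (complex.Im (1 - u (val q * t))))].
rewrite -sum1_card (partition_big cell predT) //=.
have -> : ((m.+1 ^ 2) ^ #|G| * #|bohr G rho| =
   \sum_(phi : {ffun {q | q \in G} -> 'I_m.+1 * 'I_m.+1}) #|bohr G rho|)%N.
  rewrite sum_nat_const card_ffun card_prod card_ord card_sig.
  by congr (_ ^ _ * _)%N; apply: eq_card => q; rewrite inE.
apply: leq_sum => phi _; rewrite sum1_card.
set X := (X in #|X|).
have [->//|/card_gt0P[t0]] := posnP #|X|.
rewrite unfold_in => /andP[t0G /eqP t0phi].
rewrite -(card_imset X (addIr (- t0))); apply: subset_leq_card.
apply/subsetP => y /imsetP[t]; rewrite unfold_in => /andP[tG /eqP tphi] ->.
apply/bohrP => q qG; rewrite mulrBr char_distB.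
move/bohrP: tG => /(_ q qG) tq; move/bohrP: t0G => /(_ q qG) t0q.
have := congr1 (fun f : {ffun _ -> _} => f (exist _ q qG)) (etrans t0phi (esym tphi)).
rewrite !ffunE /= => -[er ei].
have -> : u (q * t0) - u (q * t) = (1 - u (q * t)) - (1 - u (q * t0)) by ring.
apply: modc_le_cell; rewrite raddfB /=; apply: cell1P => //;
  by [apply: le_trans (Re_le_modc _) _ | apply: le_trans (Im_le_modc _) _].
Qed.

Lemma bohr_full G : bohr G 2 = [set: 'F_p].
Proof. by apply/setP => t; rewrite in_setT; apply/bohrP => q _; apply: char_dist_le2. Qed.

(** Pigeonhole: the Bohr set of radius 2 is the whole group, too large to be covered if the one of
    radius [rho] were reduced to 0. The 8 is [4 * 2] from the covering bound. *)
Lemma bohr_nonzero G rho m : 0 < rho -> 8 < m.+1%:R * rho ->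
  ((m.+1 ^ 2) ^ #|G| < #|'F_p|)%N -> exists2 t, t \in bohr G rho & t != 0.
Proof.
move=> rho0 mrho small.
have [/existsP[t /andP[]]|] := boolP [exists t, (t \in bohr G rho) && (t != 0)].
  by exists t.
move=> /existsPn none; exfalso.
have B1 : (#|bohr G rho| <= 1)%N.
  rewrite -(cards1 (0 : 'F_p)); apply: subset_leq_card; apply/subsetP => t tB.
  by have := none t; rewrite tB /= negbK inE.
have h8 : 4 * 2 < m.+1%:R * rho by rewrite (_ : 4 * 2 = 8) // -natrM.
have := card_bohr_cover G rho0 h8; rewrite bohr_full cardsT.
rewrite leqNgt => /negP; apply; apply: leq_ltn_trans small.
by rewrite -[leqRHS]muln1 leq_mul2l B1 orbT.
Qed.

(* The radii [rho / 2 + k * rho / (160 M D)] cannot all be irregular: otherwise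
   the size of the Bohr set would grow by a factor above [81 ^ #|G|] from
   [rho / 2] to [rho], against the covering bound. *)
Lemma bohr_regular G rho M D : 0 < rho -> (0 < M)%N -> (#|G| < D)%N ->
  exists2 s, rho / 2 <= s <= rho &
    #|bohr G (s + rho / (160 * M * D)%:R)|%:R
      <= (1 + M%:R^-1) * #|bohr G s|%:R :> R.
Proof.
move=> rho0 M0 GD; set delta := rho / (160 * M * D)%:R.
have M0' : 0 < M%:R :> R by rewrite ltr0n.
have D0' : 0 < D%:R :> R by rewrite ltr0n (leq_ltn_trans _ GD).
pose K := (80 * M * D)%N; pose s k := rho / 2 + k%:R * delta.
have sK : s K = rho by rewrite /s /K /delta !natrM; field; rewrite !gt_eqF.
have delta0 : 0 < delta by rewrite divr_gt0 // !natrM !mulr_gt0.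
have s_le k : (k <= K)%N -> s k <= rho.
  by move=> kK; rewrite -sK lerD2l ler_wpM2r ?ler_nat// ltW.
have s_ge k : rho / 2 <= s k by rewrite lerDl mulr_ge0// ltW.
have s_S k : s k.+1 = s k + delta by rewrite /s -natr1; ring.
pose b k : R := #|bohr G (s k)|%:R.
have [/existsP[k kP]|/existsPn none] :=
  boolP [exists k : 'I_K, b k.+1 <= (1 + M%:R^-1) * b k].
  by exists (s k); rewrite ?s_ge ?s_le ?(ltnW (ltn_ord k))//; rewrite -s_S.
exfalso.
have M1 : 0 < 1 + M%:R^-1 :> R by rewrite addr_gt0// invr_gt0.
have grow k : (k <= K)%N -> (1 + M%:R^-1) ^+ k * b 0%N <= b k.
  elim: k => [|k IH] kK; first by rewrite mul1r.
  have := none (Ordinal kK); rewrite -ltNge => /ltW; apply: le_trans.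
  by rewrite exprS -mulrA ler_pM2l// IH// ltnW.
have := grow K (leqnn K); rewrite leNgt => /negP; apply.
have s0 : s 0%N = rho / 2 by rewrite /s mul0r addr0.
have b0 : 0 < b 0%N.
  by rewrite /b s0 ltr0n card_bohr_gt0// divr_ge0// ltW.
(* Nine cells per coordinate suffice, as [4 * rho < 9 * (rho / 2)]; each frequency costs a factor
   [9 ^ 2 = 81]. *)
have cover : b K <= 81 ^+ #|G| * b 0%N.
  rewrite /b -natrX -natrM ler_nat s0 sK.
  by apply: (@card_bohr_cover G (rho / 2) rho 8); lra.
apply: le_lt_trans cover _; rewrite ltr_pM2r//.
apply: (@lt_le_trans _ _ (81 ^+ D)); first by rewrite ltr_eXn2l ?ltr1n.
(* By Bernoulli, [(1 + 1 / M) ^ (80 M) >= 1 + 80 = 81], whence the 80 in [K]. *)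
rewrite /K exprM lerXn2r ?nnegrE ?exprn_ge0 ?(ltW M1)//.
apply: le_trans (bernoulli_ineq _ _); last by rewrite invr_ge0 ltW.
by rewrite natrM mulfK ?gt_eqF// natr1.
Qed.

(** The Bohr set and its translate by [t] have the same size and both lie in the Bohr set of radius
    [s + delta]; each misses at most a proportion [eta] of points, on which [F] is bounded by 1. *)
Lemma sum_bohr_shift G s delta (eta : R) (F : 'F_p -> R[i]) t :
  (forall x, modc (F x) <= 1) -> t \in bohr G delta -> 0 <= delta ->
  #|bohr G (s + delta)|%:R <= (1 + eta) * #|bohr G s|%:R ->
  modc (\sum_(x in bohr G s) F (x + t) - \sum_(x in bohr G s) F x)
    <= 2 * eta * #|bohr G s|%:R.
Proof.
move=> F1 tG delta0 reg; set B := bohr G s; set B' := bohr G (s + delta).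
have sub (A : {set 'F_p}) : A \subset B' -> #|A| = #|B| ->
    modc (\sum_(x in B') F x - \sum_(x in A) F x) <= eta * #|B|%:R.
  move=> AB cA; rewrite (big_setID A) /= (setIidPr AB) [X in X - _]addrC addrK.
  apply: le_trans (modc_sum _ _ _) _.
  apply: (@le_trans _ _ (\sum_(x in B' :\: A) 1)); first exact: ler_sum.
  rewrite sumr_const cardsD (setIidPr AB) cA natrB; last first.
    by rewrite -cA subset_leq_card.
  by rewrite lerBlDl; apply: le_trans reg _; rewrite mulrDl mul1r.
have inj : injective (fun x => x + t) by exact: addIr.
have -> : \sum_(x in B) F (x + t) = \sum_(x in [set x + t | x in B]) F x.
  by rewrite big_imset//= => x y _ _; apply: inj.
have h1 : modc (\sum_(x in B') F x - \sum_(x in [set x + t | x in B]) F x)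
    <= eta * #|B|%:R.
  apply: sub; last by rewrite card_imset.
  by apply/subsetP => _ /imsetP[x xB ->]; apply: bohrD.
have h2 : modc (\sum_(x in B') F x - \sum_(x in B) F x) <= eta * #|B|%:R.
  by apply: sub => //; apply: bohrS => //; rewrite lerDl.
set a := \sum_(x in B') _ in h1 h2.
set c := \sum_(x in [set _ | _ in _]) _ in h1 *.
set d := \sum_(x in B) _ in h2 *.
have -> : c - d = (a - d) - (a - c) by ring.
by apply: le_trans (modcB _ _) _; apply: le_trans (lerD h2 h1) _; lra.
Qed.

End Bohr.

(** * Combinatorics: popular neighbourhoods and constancy of sign *)

(* [Delta] is a maximal family of popular vertices with pairwise disjoint
   neighbourhoods, and [S] the union of the neighbourhoods of popular vertices. *)
Lemma popular_neighbourhoods (R : realDomainType) (T : finType) (w : T -> R)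
    (close : rel T) (U : {set T}) (theta : R) :
  (forall r, 0 <= w r) -> \sum_r w r <= 1 -> reflexive close -> 0 <= theta ->
  2 * theta < \sum_(r in U) \sum_(s in U | close r s) w r * w s ->
  exists Delta S : {set T},
    [/\ S \subset U, theta < (\sum_(s in S) w s) ^+ 2,
        #|Delta|%:R * theta <= \sum_(s in S) w s &
        forall s, s \in S -> exists d r s',
          [/\ d \in Delta, close r s, close r s' & close d s']].
Proof.
move=> w0 w1 cxx theta0 edges.
pose cloud r := [set s in U | close r s].
pose pop := [set r in U | theta <= \sum_(s in cloud r) w s].
pose S := \bigcup_(r in pop) cloud r.
have cloudS r : r \in pop -> cloud r \subset S by move=> rP; exact: bigcup_sup.
have popS : pop \subset S.
  apply/subsetP => r rP; apply: (subsetP (cloudS r rP)).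
  by move: rP; rewrite !inE => /andP[-> _]; rewrite cxx.
pose good (X : {set T}) := (X \subset pop) &&
  [forall a in X, forall b in X, (a != b) ==> [disjoint cloud a & cloud b]].
have good0 : good set0.
  by rewrite /good sub0set; apply/forall_inP => a; rewrite inE.
have [Delta /maxsetP[/andP[Dpop /forall_inP Ddisj] Dmax] _] := maxset_exists good0.
exists Delta, S; split.
- by apply/bigcupsP => r _; apply/subsetP => s; rewrite inE => /andP[].
- have sumE r : \sum_(s in U | close r s) w r * w s = w r * \sum_(s in cloud r) w s.
    by rewrite -mulr_sumr; congr (_ * _); apply: eq_bigl => s; rewrite inE.
  (* Unpopular vertices contribute at most [theta] because the total weight is at most 1. *)
  have popsum : theta < \sum_(r in pop) w r * \sum_(s in cloud r) w s.
    move: edges; rewrite (eq_bigr _ (fun r _ => sumE r)).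
    rewrite (bigID (fun r => theta <= \sum_(s in cloud r) w s)) /=.
    set A := \sum_(r in U | _) _; set A' := \sum_(r in U | _) _.
    have -> : \sum_(r in pop) w r * \sum_(s in cloud r) w s = A.
      by apply: eq_bigl => r; rewrite inE.
    suff : A' <= theta by lra.
    apply: (@le_trans _ _ (\sum_r w r * theta)).
      rewrite [leRHS](bigID (fun r => (r \in U) && ~~ (theta <= \sum_(s in cloud r) w s))) /=.
      rewrite -[leLHS]addr0 lerD//; last by apply: sumr_ge0 => r _; rewrite mulr_ge0.
      apply: ler_sum => r /andP[_]; rewrite -ltNge => /ltW h.
      by rewrite ler_wpM2l.
    by rewrite -mulr_suml ler_piMl.
  (* Popular vertices, by reflexivity, and their neighbourhoods all lie in [S]. *)
  apply: lt_le_trans popsum _; rewrite expr2 mulr_suml.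
  rewrite [leRHS](big_setID pop) /= (setIidPr popS).
  rewrite -[leLHS]addr0 lerD//; last first.
    by apply: sumr_ge0 => r _; rewrite mulr_ge0// sumr_ge0.
  apply: ler_sum => r rP; rewrite ler_wpM2l//.
  rewrite [leRHS](big_setID (cloud r)) /= (setIidPr (cloudS r rP)).
  by rewrite lerDl sumr_ge0.
- apply: (@le_trans _ _ (\sum_(d in Delta) \sum_(s in cloud d) w s)).
    rewrite mulr_natl -sumr_const.
    apply: ler_sum => d dD; move/subsetP: Dpop => /(_ d dD).
    by rewrite inE => /andP[].
  rewrite (exchange_big_dep (fun s => s \in S)) /=; last first.
    by move=> d s dD; apply: (subsetP (cloudS d (subsetP Dpop d dD))).
  apply: ler_sum => s sS.
  have [/existsP[d /andP[dD sd]]|/existsPn none] :=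
      boolP [exists d, (d \in Delta) && (s \in cloud d)]; last first.
    by rewrite big_pred0 // => d; apply/negbTE/none.
  rewrite (bigD1 d) ?dD//= big_pred0 ?addr0// => b.
  apply/negbTE/negP => /andP[/andP[bD sb] bd].
  have /forall_inP/(_ b bD)/implyP := Ddisj d dD; rewrite eq_sym => /(_ bd).
  by move/disjointFr/(_ sd); rewrite sb.
move=> s /bigcupP[r rP]; rewrite inE => /andP[sU crs].
suff [d [s' [dD c1 c2]]] : exists d s', [/\ d \in Delta, close r s' & close d s'].
  by exists d, r, s'.
have [rD|rD] := boolP (r \in Delta); first by exists r, r; rewrite cxx.
(* By maximality the neighbourhood of [r] meets that of some [d] in [Delta]; a common point serves
   as [s']. *)
have : ~~ good (r |: Delta).
  apply/negP => /Dmax /(_ (subsetUr _ _)) e.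
  by rewrite -e setU11 in rD.
rewrite /good subUset sub1set rP Dpop /= => /forall_inPn[a aX] /forall_inPn[b bX].
rewrite negb_imply => /andP[ab].
have key d : d \in Delta -> ~~ [disjoint cloud r & cloud d] ->
    exists d s', [/\ d \in Delta, close r s' & close d s'].
  move=> dD /pred0Pn[s' /andP[]] /=; rewrite !inE => /andP[_ c1] /andP[_ c2].
  by exists d, s'.
case/setU1P: aX => [ea|aD]; case/setU1P: bX => [eb|bD].
- by rewrite ea eb eqxx in ab.
- by rewrite ea; apply: key.
- by rewrite eb disjoint_sym; apply: key.
by have /forall_inP/(_ b bD)/implyP/(_ ab) -> := Ddisj a aD.
Qed.

(** A nonzero [t] generates the additive group of the field, so invariance of the sign under the
    shift by [t] makes it constant. *)
Lemma sum_same_sign_neq0 (R : realDomainType) (p : nat) (m : 'F_p -> R) (t : 'F_p) :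
  t != 0 -> (forall x, m x != 0) ->
  (forall x, (0 < m (x + t)) = (0 < m x)) -> \sum_x m x != 0.
Proof.
move=> t0 m0 mt.
have mtn k : (0 < m (t *+ k)) = (0 < m 0).
  by elim: k => [|k <-]; rewrite ?mulr0n// mulrSr mt.
have mx x : (0 < m x) = (0 < m 0).
  rewrite -(mtn (x / t)); congr (0 < m _).
  by rewrite -mulr_natl natr_Zp divfK.
rewrite (bigD1 0) //=.
have [h|h] := boolP (0 < m 0).
  apply: lt0r_neq0; rewrite ltr_pwDl// sumr_ge0// => x _.
  by rewrite ltW// mx.
apply: ltr0_neq0; rewrite ltr_nwDl// ?sumr_le0//.
  by rewrite lt_neqAle m0 leNgt.
by move=> x _; rewrite leNgt mx.
Qed.

(** * Mass increment for a trigonometric polynomial without small values *)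

Section SmallValue.
Variables (R : realType) (p : nat) (u : 'F_p -> R[i]).
Hypotheses (uD : {morph u : x y / x + y >-> x * y})
           (u_mod : forall x, modc (u x) = 1).
Variables (c : 'F_p -> R[i]) (h : 'F_p -> R).
Hypotheses (c_sum : \sum_r modc (c r) <= 1)
           (hE : forall x, (h x)%:C%C = \sum_r c r * u (r * x))
           (h_sum : \sum_x h x = 0).
Implicit Types (x y t q r s : 'F_p) (G K U B : {set 'F_p}) (rho sigma : R).

Let w r := modc (c r).

Let w_ge0 r : 0 <= w r.
Proof. exact: modc_ge0. Qed.

Definition partial_sum U x : R[i] := \sum_(r in U) c r * u (r * x).

Lemma partial_sumC U x : (h x)%:C%C = partial_sum U x + partial_sum (~: U) x.
Proof.
rewrite hE (bigID (mem U)) /=; congr (_ + _).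
by apply: eq_bigl => r; rewrite inE.
Qed.

Lemma weight_le1 U : \sum_(r in U) w r <= 1.
Proof.
apply: le_trans c_sum; rewrite [leRHS](bigID (mem U)) /= lerDl.
by apply: sumr_ge0 => r _; apply: modc_ge0.
Qed.

Lemma norm_h_le1 x : `|h x| <= 1.
Proof.
rewrite -modc_real hE; apply: le_trans c_sum; apply: le_trans (modc_sum _ _ _) _.
by apply: ler_sum => r _; rewrite modcM u_mod mulr1.
Qed.

(** Expand the square and sum over [t] first; [x] enters only through the unimodular factors
    [u ((r - s) * x)], which the moduli remove. *)
Lemma sum_sqr_partial_sum U B x :
  \sum_(t in B) modc (partial_sum U (x + t)) ^+ 2
  <= \sum_(r in U) \sum_(s in U) w r * w s * modc (\sum_(t in B) u ((r - s) * t)).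
Proof.
set L := \sum_(t in B) _; have L0 : 0 <= L by apply: sumr_ge0 => t _; apply: sqr_ge0.
have -> : L = modc L%:C%C by rewrite modc_real ger0_norm.
have -> : L%:C%C = \sum_(r in U) \sum_(s in U)
    c r * (c s)^*%C * u ((r - s) * x) * \sum_(t in B) u ((r - s) * t).
  rewrite rmorph_sum /=.
  transitivity (\sum_(t in B) \sum_(r in U) \sum_(s in U)
      c r * (c s)^*%C * u ((r - s) * x) * u ((r - s) * t)).
    apply: eq_bigr => t _; rewrite sqr_modc /partial_sum rmorph_sum /= mulr_suml.
    apply: eq_bigr => r _; rewrite mulr_sumr; apply: eq_bigr => s _.
    rewrite rmorphM /= -(charN uD u_mod) mulrACA -uD -!mulrA -uD !mulrA.
    by congr (_ * u _); ring.
  rewrite exchange_big; apply: eq_bigr => r _ /=.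
  by rewrite exchange_big; apply: eq_bigr => s _ /=; rewrite mulr_sumr.
apply: le_trans (modc_sum _ _ _) _; apply: ler_sum => r _.
apply: le_trans (modc_sum _ _ _) _; apply: ler_sum => s _.
by rewrite !modcM u_mod mulr1 modc_conj.
Qed.

(** Shifting by [t] multiplies the sum by [u (q * t)], farther than [kappa] from 1, while regularity
    allows it to change only slightly. *)
Lemma char_sum_regular_small G sigma delta (eta kappa : R) q t :
  t \in bohr u G delta -> 0 <= delta -> 0 < kappa ->
  #|bohr u G (sigma + delta)|%:R <= (1 + eta) * #|bohr u G sigma|%:R ->
  kappa < modc (1 - u (q * t)) ->
  modc (\sum_(x in bohr u G sigma) u (q * x)) <= 2 * eta / kappa * #|bohr u G sigma|%:R.
Proof.
move=> tG delta0 kappa0 reg big.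
have F1 x : modc (u (q * x)) <= 1 by rewrite u_mod.
have := sum_bohr_shift uD u_mod F1 tG delta0 reg.
rewrite (eq_bigr (fun x => u (q * t) * u (q * x))); last first.
  by move=> x _; rewrite -uD mulrDr addrC.
rewrite -mulr_sumr -[X in _ - X]mul1r -mulrBl modcM modcBC => le.
have : kappa * modc (\sum_(x in bohr u G sigma) u (q * x)) <= 2 * eta * #|bohr u G sigma|%:R.
  by apply: le_trans le; rewrite ler_wpM2r ?modc_ge0// ltW.
by rewrite mulrC -ler_pdivlMr// => le'; apply: le_trans le' _; rewrite mulrAC.
Qed.

Variable e : R.
Hypotheses (e_gt0 : 0 < e) (h_large : forall x, e < `|h x|).

(* The means of [h] over the translates of a regular Bohr set stay away from 0
   and vary slowly, hence all have the same sign, while they average to 0. *)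
Lemma regular_bohr_variance_large G K sigma delta (eta : R) t :
  0 <= delta -> 2 * eta < e -> t \in bohr u G delta -> t != 0 -> 0 <= sigma ->
  #|bohr u G (sigma + delta)|%:R <= (1 + eta) * #|bohr u G sigma|%:R ->
  (forall r, r \in K -> forall y, y \in bohr u G sigma -> modc (1 - u (r * y)) <= e / 8) ->
  exists x, e ^+ 2 / 64 * #|bohr u G sigma|%:R
    < \sum_(y in bohr u G sigma) modc (partial_sum (~: K) (x + y)) ^+ 2.
Proof.
move=> delta0 eta_e tG t0 sigma0 reg killed; set B := bohr u G sigma.
have [/existsP[x xP]|/existsPn none] := boolP [exists x, e ^+ 2 / 64 * #|B|%:R
    < \sum_(y in B) modc (partial_sum (~: K) (x + y)) ^+ 2]; first by exists x.
exfalso.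
have small x : \sum_(y in B) modc (partial_sum (~: K) (x + y)) ^+ 2
    <= e ^+ 2 / 64 * #|B|%:R.
  by rewrite leNgt.
have cardB : 0 < #|B|%:R :> R by rewrite ltr0n (card_bohr_gt0 uD u_mod).
have constB (z : R) : \sum_(y in B) z = z * #|B|%:R by rewrite sumr_const mulr_natr.
pose m x := \sum_(y in B) h (x + y).
(* Freezing the frequencies of [K] at [x] costs [e / 8], and the others cost [e / 8] on average;
   hence [|a| >= 3 e / 4] and the mean is at least [3 e / 4 - e / 4]. *)
have m_large x : e / 2 * #|B|%:R <= `|m x|.
  pose a := partial_sum K x.
  have near : \sum_(y in B) modc ((h (x + y))%:C%C - a) <= e / 4 * #|B|%:R.
    apply: (@le_trans _ _ (\sum_(y in B)
       (e / 8 + (4 / e * modc (partial_sum (~: K) (x + y)) ^+ 2 + e / 16)))).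
      apply: ler_sum => y yB; rewrite (partial_sumC K) addrAC.
      apply: le_trans (modcD _ _) (lerD _ _).
        rewrite /a /partial_sum -sumrB; apply: le_trans (modc_sum _ _ _) _.
        apply: (@le_trans _ _ (\sum_(r in K) w r * (e / 8))).
          apply: ler_sum => r rK; rewrite mulrDr uD.
          rewrite (_ : _ - _ = c r * u (r * x) * - (1 - u (r * y))); last by ring.
          rewrite !modcM u_mod mulr1 modcN ler_wpM2l// ?w_ge0//.
          exact: killed.
        by rewrite -mulr_suml ler_piMl ?weight_le1 ?divr_ge0 ?(ltW e_gt0).
      (* Completing a square replaces Cauchy-Schwarz: a mean of [b ^ 2] up to [e ^ 2 / 64] gives a
         mean of [b] up to [e / 16 + e / 16]. *)
      set b := modc _; have -> : 4 / e * b ^+ 2 + e / 16 =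
         b + (2 * b - e / 4) ^+ 2 / e by field; rewrite gt_eqF.
      by rewrite lerDl divr_ge0 ?sqr_ge0// ltW.
    rewrite big_split /= big_split /= !constB -mulr_sumr.
    have := ler_wpM2l (_ : 0 <= 4 / e) (small x).
    have -> : 4 / e * (e ^+ 2 / 64 * #|B|%:R) = e / 16 * #|B|%:R.
      by field; rewrite gt_eqF.
    move=> /(_ (divr_ge0 (ler0n _ _) (ltW e_gt0))) le.
    by rewrite addrCA; apply: le_trans (lerD le (lexx _)) _; lra.
  have a_large : 3 / 4 * e <= modc a.
    have : e * #|B|%:R <= (e / 4 + modc a) * #|B|%:R.
      apply: (@le_trans _ _ (\sum_(y in B) (modc ((h (x + y))%:C%C - a) + modc a))).
        rewrite -constB; apply: ler_sum => y _.
        by apply: ltW; apply: lt_le_trans (h_large (x + y)) _;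
           rewrite -modc_real -{1}(subrK a (h _)%:C%C) modcD.
      by rewrite big_split /= constB mulrDl lerD2r.
    by rewrite ler_pM2r//; lra.
  have : modc ((m x)%:C%C - a *+ #|B|) <= e / 4 * #|B|%:R.
    apply: le_trans near; rewrite rmorph_sum -sumr_const -sumrB.
    exact: modc_sum.
  have aB : modc (a *+ #|B|) = modc a * #|B|%:R.
    rewrite -[a *+ _]mulr_natr modcM; congr (_ * _).
    by rewrite -[RHS]ger0_norm ?ler0n// -modc_real rmorph_nat.
  have := modcB (m x)%:C%C ((m x)%:C%C - a *+ #|B|).
  rewrite subKr aB modc_real => h1 h2.
  have : 3 / 4 * e * #|B|%:R <= modc a * #|B|%:R by rewrite ler_pM2r.
  lra.
(* A change of sign would need a jump of at least twice [e / 2 * #|B|]. *)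
have m_shift x : `|m (x + t) - m x| < e * #|B|%:R.
  have F1 y : modc (h (x + y))%:C%C <= 1 by rewrite modc_real norm_h_le1.
  have := sum_bohr_shift uD u_mod F1 tG delta0 reg; rewrite -/B.
  have <- : (m x)%:C%C = \sum_(y in B) (h (x + y))%:C%C by rewrite rmorph_sum.
  have <- : (m (x + t))%:C%C = \sum_(y in B) (h (x + (y + t)))%:C%C.
    by rewrite rmorph_sum; apply: eq_bigr => y _; rewrite addrAC addrA.
  rewrite -rmorphB modc_real => le; apply: le_lt_trans le _.
  by rewrite ltr_pM2r.
have m0 x : m x != 0.
  by rewrite -normr_gt0; apply: lt_le_trans (m_large x); rewrite mulr_gt0// divr_gt0.
have mt x : (0 < m (x + t)) = (0 < m x).
  have := m_shift x; have := m_large x; have := m_large (x + t).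
  have [h1|h1|h1] := ltrgt0P (m (x + t)); have [h2|h2|h2] := ltrgt0P (m x) => //;
    rewrite ?h1 ?h2 ?ltr_norml ?ler_norml; lra.
have /eqP := sum_same_sign_neq0 t0 m0 mt; apply.
rewrite exchange_big /=; apply: big1 => y _.
by rewrite (reindex_inj (addIr (- y))) /= -[RHS]h_sum; apply: eq_bigr => x _; rewrite subrK.
Qed.

Definition slow_freqs G rho : {set 'F_p} :=
  [set r | [forall t in bohr u G rho, modc (1 - u (r * t)) <= e / 8]].

Lemma slow_freqsP G rho r :
  reflect (forall t, t \in bohr u G rho -> modc (1 - u (r * t)) <= e / 8)
          (r \in slow_freqs G rho).
Proof. by rewrite inE; apply: (iffP forall_inP). Qed.

(** The quantity that increases along the iteration; it is bounded by 1. *)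
Definition slow_mass G rho := \sum_(r in slow_freqs G rho) modc (c r).

(** One step of the iteration. The first inequality bounds the number of steps; the second charges
    every new frequency to gained mass, so the total number of frequencies stays bounded however
    they are spread over the steps. *)
Lemma slow_mass_step G rho M D t :
  e <= 1 -> 0 < rho -> rho <= e / 32 -> (0 < M)%N ->
  2 * M%:R^-1 <= e ^+ 2 / 128 * (e / 32) ->
  (#|G| < D)%N -> t \in bohr u G (rho / (160 * M * D)%:R) -> t != 0 ->
  exists Delta : {set 'F_p},
    slow_mass G rho + e / 16 < slow_mass (G :|: Delta) (rho / (160 * M * D)%:R) /\
    #|Delta|%:R * ((e / 16) ^+ 2)
      <= slow_mass (G :|: Delta) (rho / (160 * M * D)%:R) - slow_mass G rho.
Proof.
move=> e1 rho0 rho_e M0 Me GD tG t0.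
have [sigma /andP[s1 s2] reg] := bohr_regular uD u_mod rho0 M0 GD.
set delta := rho / (160 * M * D)%:R in tG reg *.
have M0' : 0 < M%:R :> R by rewrite ltr0n.
have D0 : (0 < D)%N by exact: leq_ltn_trans GD.
have delta0 : 0 < delta by rewrite divr_gt0// ltr0n !muln_gt0 M0.
have delta_le : delta <= rho.
  by rewrite ler_pdivrMr ?ltr0n ?muln_gt0 ?M0// ler_peMr ?(ltW rho0)// ler1n !muln_gt0 M0.
have sigma0 : 0 <= sigma by apply: le_trans s1; rewrite divr_ge0 ?ltW.
have e2 : e ^+ 2 <= 1 by rewrite expr_le1// ltW.
have e32 : 0 < e / 32 by rewrite divr_gt0.
have eta_e : 2 * M%:R^-1 < e.
  apply: le_lt_trans Me _; apply: (@le_lt_trans _ _ (1 * (e / 32))); last by lra.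
  by apply: ler_wpM2r; [exact: ltW | lra].
set B := bohr u G sigma in reg *.
have cardB : 0 < #|B|%:R :> R by rewrite ltr0n (card_bohr_gt0 uD u_mod).
pose K := slow_freqs G rho.
have killed r : r \in K -> forall y, y \in B -> modc (1 - u (r * y)) <= e / 8.
  move=> /slow_freqsP rK y yB; apply: rK.
  by apply: (subsetP (bohrS u (subxx G) s2)).
have [x] := regular_bohr_variance_large (ltW delta0) eta_e tG t0 sigma0 reg killed.
move=> /lt_le_trans/(_ (sum_sqr_partial_sum _ _ _)) energy.
pose close r s := [forall y in bohr u G delta, modc (1 - u ((r - s) * y)) <= e / 32].
have closeP r s : reflect (forall y, y \in bohr u G delta ->
    modc (1 - u ((r - s) * y)) <= e / 32) (close r s).
  by apply: (iffP forall_inP).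
have closexx : reflexive close.
  move=> r; apply/closeP => y _; rewrite subrr mul0r (char0 uD u_mod) subrr modc0.
  by rewrite divr_ge0 ?ltW.
(* With [eta = 1 / M] and [kappa = e / 32], the hypothesis on [M] says
   [2 * eta / kappa <= e ^ 2 / 128]. *)
have far r s : ~~ close r s ->
    modc (\sum_(y in B) u ((r - s) * y)) <= e ^+ 2 / 128 * #|B|%:R.
  move=> /forall_inPn[y yG]; rewrite -ltNge => big.
  apply: le_trans (char_sum_regular_small yG (ltW delta0) e32 reg big) _.
  by rewrite ler_wpM2r ?(ltW cardB)// ler_pdivrMr.
have edges : 2 * ((e / 16) ^+ 2) <
    \sum_(r in ~: K) \sum_(s in ~: K | close r s) w r * w s.
  set E := \sum_(r in _) _.
  (* Pairs that are not close account for at most half of [e ^ 2 / 64]; the other half is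
     [2 * (e / 16) ^ 2]. *)
  suff : e ^+ 2 / 64 * #|B|%:R < (E + e ^+ 2 / 128) * #|B|%:R.
    rewrite ltr_pM2r//; have -> : e ^+ 2 / 64 = 2 * (e / 16) ^+ 2 + e ^+ 2 / 128 by field.
    by rewrite ltrD2r.
  apply: lt_le_trans energy _.
  apply: (@le_trans _ _ (\sum_(r in ~: K) ((\sum_(s in ~: K | close r s) w r * w s)
      * #|B|%:R + w r * (e ^+ 2 / 128 * #|B|%:R)))).
    apply: ler_sum => r _; rewrite (bigID (close r)) /=; apply: lerD.
      rewrite mulr_suml; apply: ler_sum => s _; rewrite ler_wpM2l ?mulr_ge0//.
      apply: le_trans (modc_sum _ _ _) _; rewrite (eq_bigr (fun _ => 1)) => [|y _].
        by rewrite sumr_const.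
      exact: u_mod.
    apply: (@le_trans _ _ (\sum_(s in ~: K | ~~ close r s)
        w s * (w r * (e ^+ 2 / 128 * #|B|%:R)))).
      apply: ler_sum => s /andP[_ rs]; rewrite mulrCA mulrA ler_wpM2l ?mulr_ge0//.
      exact: far.
    rewrite -mulr_suml ler_piMl//.
      by rewrite !mulr_ge0// ?invr_ge0// ?sqr_ge0// ltW.
    apply: le_trans (weight_le1 (~: K)).
    rewrite [leRHS](bigID (close r)) /= lerDr.
    by apply: sumr_ge0.
  rewrite big_split /= -!mulr_suml mulrDl lerD2l.
  by rewrite ler_piMl ?weight_le1// mulr_ge0 ?(ltW cardB)// divr_ge0 ?sqr_ge0.
have theta0 : 0 <= (e / 16) ^+ 2 by exact: sqr_ge0.
have [Delta [S [SU Sbig Dsmall Sclose]]] :=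
  popular_neighbourhoods w_ge0 c_sum closexx theta0 edges.
exists Delta.
have gain : slow_mass G rho + \sum_(s in S) w s <= slow_mass (G :|: Delta) delta.
  have KS : [disjoint K & S] by rewrite disjoint_sym disjoints_subset.
  have -> : slow_mass G rho + \sum_(s in S) w s = \sum_(s in K :|: S) w s.
    by rewrite -bigU //=; apply: eq_bigl => r; rewrite !inE.
  have sub : K :|: S \subset slow_freqs (G :|: Delta) delta.
    rewrite subUset; apply/andP; split; apply/subsetP => s.
      move=> /slow_freqsP sK; apply/slow_freqsP => y yG; apply: sK.
      by apply: (subsetP (bohrS u (subsetUl G Delta) delta_le)).
    move=> /Sclose[d [r [s' [dD /closeP c1 /closeP c2 /closeP c3]]]].
    apply/slow_freqsP => y yG.
    have yd : modc (1 - u (d * y)) <= delta.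
      by move/bohrP: yG; apply; rewrite inE dD orbT.
    have {}yG := subsetP (bohrS u (subsetUl G Delta) (lexx delta)) y yG.
    have := c1 y yG; rewrite -(char_distN uD u_mod) -mulNr opprB => {}c1.
    have := c3 y yG; rewrite -(char_distN uD u_mod) -mulNr opprB => {}c3.
    have {}c2 := c2 y yG.
    (* Three links of length [e / 32], plus [d] itself, bounded by [delta <= rho <= e / 32]: in
       total [e / 8], the threshold for slow frequencies. *)
    have -> : s * y = (s - r) * y + ((r - s') * y + ((s' - d) * y + d * y)) by ring.
    do 3! (apply: le_trans (char_distD uD u_mod _ _) _; rewrite addrC -lerBrDr).
    by apply: le_trans yd _; lra.
  rewrite /slow_mass [leRHS](big_setID (K :|: S)) /= (setIidPr sub) lerDl.
  by apply: sumr_ge0 => r _; apply: modc_ge0.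
have Sbig' : e / 16 < \sum_(s in S) w s.
  rewrite ltNge; apply/negP => le.
  have : (\sum_(s in S) w s) ^+ 2 <= (e / 16) ^+ 2.
    by rewrite lerXn2r ?nnegrE ?sumr_ge0// divr_ge0// ltW.
  by rewrite leNgt Sbig.
split; first by apply: lt_le_trans gain; rewrite ltrD2l.
by apply: le_trans Dsmall _; rewrite lerBrDl.
Qed.

Lemma slow_mass_ge0 G rho : 0 <= slow_mass G rho.
Proof. by apply: sumr_ge0 => r _; apply: modc_ge0. Qed.

(* [M] measures the regularity, [D] bounds the number of defining frequencies and
   [L] is the ratio of successive radii. *)
Lemma large_values_absurd n M D L :
  (0 < n)%N -> e = n%:R^-1 -> M = (64 * 128 * n ^ 3)%N -> D = (257 * n ^ 2)%N ->
  L = (160 * M * D)%N ->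
  (((257 * n * L ^ (16 * n).+1) ^ 2) ^ (256 * n ^ 2) < #|'F_p|)%N -> False.
Proof.
move=> n0 en ME DE LE Lp.
have n0' : 0 < n%:R :> R by rewrite ltr0n.
have M0 : (0 < M)%N by rewrite ME !muln_gt0 ?expn_gt0 ?n0.
have D0 : (0 < D)%N by rewrite DE !muln_gt0 ?expn_gt0 ?n0.
have L0 : (0 < L)%N by rewrite LE !muln_gt0 M0.
have L0' : 0 < L%:R :> R by rewrite ltr0n.
have e1 : e <= 1 by rewrite en invf_le1// ler1n.
have e16 : 0 < e / 16 by rewrite divr_gt0.
have Me : 2 * M%:R^-1 <= e ^+ 2 / 128 * (e / 32).
  rewrite ME !natrM ?natrX en le_eqVlt; apply/orP; left; apply/eqP; field.
  by rewrite gt_eqF.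
pose rho j := e / 32 / L%:R ^+ j.
have rho_gt0 j : 0 < rho j by rewrite !divr_gt0 ?exprn_gt0.
have rhoS j : rho j.+1 = rho j / (160 * M * D)%:R.
  by rewrite /rho -LE exprSr invfM mulrA.
have rho_le j : rho j <= e / 32.
  rewrite ler_pdivrMr ?exprn_gt0// ler_peMr ?divr_ge0 ?(ltW e_gt0)//.
  by rewrite exprn_ege1// ler1n.
(* The first bound pays for the frequencies with mass, which keeps [#|G|] below [D]; the second
   counts the steps. *)
have main j : (j <= (16 * n).+1)%N -> exists2 G : {set 'F_p},
    #|G|%:R * (e / 16) ^+ 2 <= slow_mass G (rho j) &
    j%:R * (e / 16) <= slow_mass G (rho j).
  elim: j => [|j IH] jn.
    by exists set0; rewrite ?cards0 mul0r slow_mass_ge0.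
  have [G G1 G2] := IH (ltnW jn).
  have Gn : (#|G| <= 256 * n ^ 2)%N.
    have := le_trans G1 (weight_le1 _).
    rewrite -ler_pdivlMr ?exprn_gt0// mul1r.
    have -> : ((e / 16) ^+ 2)^-1 = (256 * n ^ 2)%:R :> R.
      by rewrite natrM ?natrX en; field; rewrite gt_eqF.
    by rewrite ler_nat.
  have GD : (#|G| < D)%N.
    apply: leq_ltn_trans Gn _; rewrite DE ltn_mul2r expn_gt0 n0 /=.
    exact: ltnSn.
  have [t tG t0] : exists2 t, t \in bohr u G (rho j.+1) & t != 0.
    (* Even at the last radius, [m * rho j.+1 >= 257 / 32 > 8]. *)
    pose m := (257 * n * L ^ (16 * n).+1)%N.
    have m0 : (0 < m)%N by rewrite !muln_gt0 n0 expn_gt0 L0.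
    apply: (@bohr_nonzero _ _ _ uD u_mod G (rho j.+1) m.-1) => //; rewrite prednK//.
      have Lpow : 1 <= L%:R ^+ (16 * n).+1 / L%:R ^+ j.+1 :> R.
        by rewrite ler_pdivlMr ?exprn_gt0// mul1r ler_weXn2l// ler1n.
      have -> : m%:R * rho j.+1 = 257 / 32 * (L%:R ^+ (16 * n).+1 / L%:R ^+ j.+1).
        rewrite /m /rho !natrM ?natrX en; field.
        by rewrite !gt_eqF ?exprn_gt0.
      by apply: lt_le_trans (ler_wpM2l _ Lpow); lra.
    by apply: leq_ltn_trans Lp; rewrite leq_pexp2l ?expn_gt0 ?m0.
  rewrite rhoS in tG.
  have [Delta [D1 D2]] := slow_mass_step e1 (rho_gt0 j) (rho_le j) M0 Me GD tG t0.
  exists (G :|: Delta); rewrite rhoS; last first.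
    by rewrite -natr1 mulrDl mul1r; apply: le_trans (ltW D1); rewrite lerD2r.
  apply: (@le_trans _ _ ((#|G| + #|Delta|)%:R * (e / 16) ^+ 2)).
    by rewrite ler_wpM2r ?sqr_ge0// ler_nat cardsU leq_subr.
  by rewrite natrD mulrDl addrC -lerBrDr; apply: le_trans D2 _; rewrite lerD2l lerN2.
(* After [16 n + 1] steps the mass would be at least [1 + e / 16]. *)
have [G _ big] := main _ (leqnn _).
have := le_trans big (weight_le1 _).
have -> : (16 * n).+1%:R * (e / 16) = 1 + e / 16.
  by rewrite -natr1 natrM en; field; rewrite gt_eqF.
lra.
Qed.
End SmallValue.

(** * Characters and Fourier analysis on the prime field *)

(** Algebraic closedness gives a root [z] of [1 + X + ... + X ^ (p - 1)], a nontrivial [p]-th root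
    of unity, and [u x = z ^ x]. Orthogonality holds because shifting [r] by 1 multiplies the sum by
    [u x]. *)
Lemma exists_character (R : realType) (p : nat) : prime p ->
  exists u : 'F_p -> R[i],
    [/\ {morph u : x y / x + y >-> x * y}, forall x, modc (u x) = 1 &
        forall x, \sum_r u (r * x) = if x == 0 then p%:R else 0].
Proof.
move=> pp; have p1 := prime_gt1 pp; have p0 := prime_gt0 pp.
have pE : (Zp_trunc (pdiv p)).+2 = p by exact: Fp_cast.
have [z zE] : exists z : R[i], z ^+ p.-1 = \sum_(i < p.-1) -1 * z ^+ i.
  by apply: (solve_monicpoly (fun _ => -1)); rewrite -ltnS prednK.
have zsum : \sum_(i < p) z ^+ i = 0.
  rewrite -(prednK p0) big_ord_recr /= zE -big_split big1// => i _ /=.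
  by rewrite mulN1r subrr.
have zp : z ^+ p = 1.
  by apply/eqP; rewrite -subr_eq0 subrX1 zsum mulr0.
have z1 : z != 1.
  apply/eqP => e; move: zsum; rewrite e (eq_bigr (fun _ => 1)) => [|i _]; last by rewrite expr1n.
  by rewrite sumr_const card_ord => /eqP; rewrite pnatr_eq0 eqn0Ngt p0.
have zmod k : modc (z ^+ k) = modc z ^+ k.
  by elim: k => [|k IH]; rewrite ?modc1// !exprS modcM IH.
have z_mod : modc z = 1.
  by apply/eqP; rewrite -(pexpr_eq1 p0) ?modc_ge0// -zmod zp modc1.
pose u (x : 'F_p) : R[i] := z ^+ (x : nat).
have uD : {morph u : x y / x + y >-> x * y}.
  move=> x y; rewrite /u -exprD -[in RHS](expr_mod _ zp); congr (_ ^+ _) => /=.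
  by congr (_ %% _)%N.
have u_mod x : modc (u x) = 1 by rewrite /u zmod z_mod expr1n.
exists u; split => // x.
have [->|x0] := eqVneq x 0.
  rewrite (eq_bigr (fun _ => 1)) => [|r _]; last by rewrite mulr0 (char0 uD u_mod).
  by rewrite sumr_const card_Fp.
(* Since 1 is a multiple of [x], [u x = 1] would force [z = u 1 = 1]. *)
have ux : u x != 1.
  apply/eqP => ux; case/negP: z1; apply/eqP.
  have uxk k : u (x *+ k) = 1.
    by elim: k => [|k IH]; rewrite ?mulr0n ?(char0 uD u_mod)// mulrSr uD IH ux mulr1.
  have <- : u 1 = z by rewrite /u /= modn_small ?expr1.
  by rewrite -(uxk (x^-1)) -mulr_natl natr_Zp mulVf.
set S := \sum_r _.
have : u x * S = S.
  rewrite /S mulr_sumr [RHS](reindex_inj (addrI 1)) /=.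
  by apply: eq_bigr => r _; rewrite mulrDl mul1r uD.
move/eqP; rewrite -subr_eq0 -{2}[S]mul1r -mulrBl mulf_eq0 subr_eq0 (negbTE ux).
by move/eqP.
Qed.

Section Fourier.
Variables (R : realType) (p : nat) (u : 'F_p -> R[i]).
Hypotheses (p_prime : prime p) (uD : {morph u : x y / x + y >-> x * y})
  (u_mod : forall x, modc (u x) = 1)
  (u_orth : forall x, \sum_r u (r * x) = if x == 0 then p%:R else 0).
Implicit Types (f g : 'F_p -> R).

Let p_neq0 : p%:R != 0 :> R[i].
Proof. by rewrite pnatr_eq0 -lt0n prime_gt0. Qed.

Definition fourier f (r : 'F_p) : R[i] :=
  p%:R^-1 * \sum_x (f x)%:C%C * u (- (r * x)).

Lemma fourier0 f : fourier f 0 = (Emean f)%:C%C.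
Proof.
rewrite /fourier /Emean rmorphM fmorphV rmorph_nat rmorph_sum; congr (_ * _).
by apply: eq_bigr => x _; rewrite mul0r oppr0 (char0 uD u_mod) mulr1.
Qed.

(** After expanding both transforms, orthogonality keeps only the terms with [z = x - y]. *)
Lemma convolution_fourier f g x :
  (convolution f g x)%:C%C = \sum_r fourier f r * fourier g r * u (r * x).
Proof.
transitivity (\sum_y \sum_z (f y)%:C%C * (g z)%:C%C * p%:R^-1 ^+ 2
    * \sum_r u (r * (x - y - z))).
  rewrite /convolution rmorphM fmorphV rmorph_nat rmorph_sum mulr_sumr.
  apply: eq_bigr => y _; rewrite (bigD1 (x - y)) //= u_orth subrr eqxx.
  rewrite big1 ?addr0 => [|z zy].
    by rewrite rmorphM; field; apply: p_neq0.
  by rewrite u_orth subr_eq0 eq_sym (negbTE zy) mulr0.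
under eq_bigr do under eq_bigr do rewrite mulr_sumr.
under eq_bigr do rewrite exchange_big.
rewrite exchange_big; apply: eq_bigr => r _ /=.
rewrite /fourier mulrACA -expr2 -[RHS]mulrA mulrC mulr_suml [_ * u _]mulr_suml mulr_suml.
apply: eq_bigr => y _; rewrite mulr_sumr mulr_suml mulr_suml; apply: eq_bigr => z _.
rewrite (_ : r * (x - y - z) = - (r * y) + (- (r * z) + r * x)); last by ring.
by rewrite !uD; ring.
Qed.

Lemma parseval f : \sum_r modc (fourier f r) ^+ 2 = p%:R^-1 * \sum_x `|f x| ^+ 2.
Proof.
apply: complexI; rewrite rmorph_sum rmorphM fmorphV rmorph_nat rmorph_sum /=.
under eq_bigr do rewrite sqr_modc.
transitivity (\sum_x \sum_y (f x)%:C%C * (f y)%:C%C * p%:R^-1 ^+ 2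
    * \sum_r u (r * (y - x))); last first.
  rewrite mulr_sumr; apply: eq_bigr => x _; rewrite (bigD1 x) //= u_orth subrr eqxx.
  rewrite big1 ?addr0 => [|y yx].
    rewrite real_normK ?num_real// rmorphXn /=; field; apply: p_neq0.
  by rewrite u_orth subr_eq0 (negbTE yx) mulr0.
under [RHS]eq_bigr do under eq_bigr do rewrite mulr_sumr.
under [RHS]eq_bigr do rewrite exchange_big.
rewrite [RHS]exchange_big; apply: eq_bigr => r _ /=.
rewrite /fourier rmorphM fmorphV rmorph_nat mulrACA -expr2 rmorph_sum /= mulrC mulr_suml mulr_suml.
apply: eq_bigr => x _; rewrite mulr_sumr mulr_suml; apply: eq_bigr => y _.
have cE : ((f y)%:C%C * u (- (r * y)))^*%C = (f y)%:C%C * u (r * y).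
  by rewrite rmorphM; congr (_ * _); [exact: conjc_real |
    rewrite -[r * y in RHS]opprK (charN uD u_mod (- (r * y)))].
rewrite cE.
rewrite (_ : r * (y - x) = - (r * x) + r * y); last by ring.
by rewrite uD; ring.
Qed.
End Fourier.

(** * Small values of the centred convolution *)

Section ConvolutionValues.
Variables (R : realType) (p : nat) (f g : 'F_p -> R).
Hypotheses (p_prime : prime p) (f_norm : norm2 f <= 1) (g_norm : norm2 g <= 1).

Let h x := convolution f g x - Emean f * Emean g.

Let norm2_sqr_le1 (k : 'F_p -> R) : norm2 k <= 1 ->
  p%:R^-1 * \sum_x `|k x| ^+ 2 <= 1.
Proof.
by rewrite /norm2 -[X in _ <= X -> _]sqrtr1 ler_sqrt.
Qed.

Lemma sum_convolution_centred : \sum_x h x = 0.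
Proof.
have p0 : p%:R != 0 :> R by rewrite pnatr_eq0 -lt0n prime_gt0.
rewrite /h sumrB sumr_const card_Fp// /convolution -mulr_sumr exchange_big /=.
under eq_bigr => y _.
  rewrite -mulr_sumr (reindex_inj (addIr y)) /=.
  under eq_bigr do rewrite addrK.
  over.
by rewrite -mulr_suml /Emean -mulr_natr; field.
Qed.

(** The coefficients are the products of the transforms, with the one at 0 deleted, which subtracts
    [Emean f * Emean g]. Their weight is at most 1 by [a b <= (a ^ 2 + b ^ 2) / 2] and Parseval. *)
Lemma convolution_expansion : exists (u : 'F_p -> R[i]) (c : 'F_p -> R[i]),
  [/\ {morph u : x y / x + y >-> x * y}, forall x, modc (u x) = 1,
      \sum_r modc (c r) <= 1 & forall x, (h x)%:C%C = \sum_r c r * u (r * x)].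
Proof.
have [u [uD u_mod u_orth]] := exists_character R p_prime.
pose c r := if r == 0 then 0 else fourier u f r * fourier u g r.
exists u, c; split => //.
  apply: (@le_trans _ _ (\sum_r (modc (fourier u f r) ^+ 2 / 2
                               + modc (fourier u g r) ^+ 2 / 2))).
    apply: ler_sum => r _; rewrite /c.
    have am (a b : R) : a * b <= a ^+ 2 / 2 + b ^+ 2 / 2.
      by have := sqr_ge0 (a - b); rewrite sqrrB; lra.
    case: ifP => _; last by rewrite modcM.
    by rewrite modc0 addr_ge0// divr_ge0 ?sqr_ge0.
  rewrite big_split /= -!mulr_suml !(parseval p_prime uD u_mod u_orth).
  by have := norm2_sqr_le1 f_norm; have := norm2_sqr_le1 g_norm; lra.
move=> x.
have -> : (h x)%:C%C = (convolution f g x)%:C%C - (Emean f)%:C%C * (Emean g)%:C%C.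
  by rewrite /h rmorphB; congr (_ - _); exact: rmorphM.
rewrite (convolution_fourier p_prime uD u_orth).
rewrite -!(fourier0 uD u_mod) (bigD1 0)//= [RHS](bigD1 0)//= /c eqxx !mul0r add0r.
rewrite (char0 uD u_mod) mulr1 addrAC subrr add0r.
by apply: eq_bigr => r /negbTE ->.
Qed.

Lemma convolution_centred_le1 x : `|h x| <= 1.
Proof.
have [u [c [uD u_mod c_sum hE]]] := convolution_expansion.
exact: (norm_h_le1 u_mod c_sum hE).
Qed.

Lemma convolution_small_value n M D L :
  (0 < n)%N -> M = (64 * 128 * n ^ 3)%N -> D = (257 * n ^ 2)%N ->
  L = (160 * M * D)%N ->
  (((257 * n * L ^ (16 * n).+1) ^ 2) ^ (256 * n ^ 2) < p)%N ->
  exists x, `|h x| <= n%:R^-1.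
Proof.
move=> n0 ME DE LE Lp.
have [/existsP[x hx]|/existsPn none] := boolP [exists x, `|h x| <= n%:R^-1].
  by exists x.
exfalso; have [u [c [uD u_mod c_sum hE]]] := convolution_expansion.
have large x : n%:R^-1 < `|h x| by rewrite ltNge none.
have e0 : 0 < n%:R^-1 :> R by rewrite invr_gt0 ltr0n.
apply: (large_values_absurd uD u_mod c_sum hE sum_convolution_centred e0 large
  n0 erefl ME DE LE).
by rewrite card_Fp.
Qed.
End ConvolutionValues.

(** * Numerical estimates and choice of [n] in terms of [p] *)

(** Since [n >= 2], all constants are absorbed into powers of [n]; the condition on [p] then follows
    from [E * n ^ 3 * ln n < ln p]. *)
Lemma bohr_size_bound : exists E : nat, forall n M D L : nat, (1 < n)%N ->
  M = (64 * 128 * n ^ 3)%N -> D = (257 * n ^ 2)%N -> L = (160 * M * D)%N ->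
  (((257 * n * L ^ (16 * n).+1) ^ 2) ^ (256 * n ^ 2) <= n ^ (E * n ^ 3))%N.
Proof.
exists ((10 + 35 * 17) * 2 * 256)%N => n M D L n1 ME DE LE.
have n0 : (0 < n)%N by exact: ltnW.
have two k : (2 ^ k <= n ^ k)%N by case: k => [|k] //; rewrite leq_exp2r.
have n257 : (257 <= n ^ 9)%N by apply: leq_trans (two 9%N).
have Mn : (M <= n ^ 16)%N.
  rewrite ME (_ : 16 = 6 + 7 + 3)%N// !expnD leq_mul2r leq_mul ?orbT//.
    exact: (two 6%N).
  exact: (two 7%N).
have Dn : (D <= n ^ 11)%N.
  by rewrite DE (_ : 11 = 9 + 2)%N// expnD leq_mul2r n257 orbT.
have Ln : (L <= n ^ 35)%N.
  rewrite LE (_ : 35 = 8 + 16 + 11)%N// !expnD !leq_mul//.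
  by apply: leq_trans (two 8%N).
have Xn : (257 * n * L ^ (16 * n).+1 <= n ^ ((10 + 35 * 17) * n))%N.
  apply: (@leq_trans (n ^ (10 * n + 35 * (17 * n)))); last by rewrite mulnDl mulnA.
  rewrite expnD leq_mul//.
    apply: (@leq_trans (n ^ 10)); first by rewrite expnSr leq_mul2r n257 orbT.
    by rewrite leq_pexp2l// leq_pmulr.
  apply: (@leq_trans ((n ^ 35) ^ (16 * n).+1)); first by rewrite leq_exp2r.
  rewrite -expnM leq_pexp2l// leq_mul2l /=.
  by rewrite (_ : 17 = 16 + 1)%N// mulnDl mul1n -addn1 leq_add2l.
apply: (@leq_trans (((n ^ ((10 + 35 * 17) * n)) ^ 2) ^ (256 * n ^ 2))).
  by rewrite leq_exp2r ?leq_exp2r// muln_gt0 expn_gt0 n0.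
rewrite -!expnM leq_pexp2l// [(n ^ 3)%N]expnS.
apply: eq_leq; rewrite -!mulnA; congr (_ * _)%N.
by rewrite mulnCA; congr (_ * _)%N; rewrite mulnCA.
Qed.

(** Makes [ln (ln p)] positive for all [p >= 3]. It rests on [expR (1 / 6) <= 6 / 5] and
    [(6 / 5) ^ 6 < 3]. *)
Lemma ln3_gt1 (R : realType) : 1 < ln 3 :> R.
Proof.
rewrite -ltr_expR lnK ?posrE//.
have h : expR 6^-1 <= 6 / 5 :> R.
  have := expR_ge1Dx (- 6^-1 : R); rewrite expRN => le.
  have e0 := expR_gt0 (6^-1 : R).
  have : (1 + - 6^-1) * expR 6^-1 <= 1 :> R by rewrite -ler_pdivlMr// div1r.
  by lra.
have -> : expR 1 = expR 6^-1 ^+ 6 :> R by rewrite -expRM_natl mulfV.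
apply: le_lt_trans (_ : (6 / 5) ^+ 6 < _).
  by rewrite lerXn2r ?nnegrE ?expR_ge0// divr_ge0.
by rewrite !exprS expr0; lra.
Qed.

Lemma powR_cube (R : realType) (q : R) : 0 <= q -> (q `^ (1 / 3)) ^+ 3 = q.
Proof.
move=> q0; rewrite -powR_mulrn ?powR_ge0// -powRrM.
by rewrite (_ : 1 / 3 * 3%:R = 1) ?powRr1//; field.
Qed.

Theorem theorem1p5 (R : realType) :
  exists C : R, 0 < C /\
    forall p : nat, prime p -> (3 <= p)%N ->
    forall f g : 'F_p -> R, norm2 f <= 1 -> norm2 g <= 1 ->
    exists x : 'F_p,
      `|convolution f g x - Emean f * Emean g|
        <= C * (ln (ln (p%:R : R)) / ln (p%:R : R)) `^ (1 / 3).
Proof.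
have [E EP] := bohr_size_bound.
have l3 := ln3_gt1 R; have ll3 : 0 < ln (ln 3) :> R by rewrite ln_gt0.
(* The 1 gives [E' >= 1], and the last term gives [E' * ln (ln p) >= 1] already at [p = 3]. *)
pose E' : R := E%:R + 1 + (ln (ln 3))^-1.
have E'E : E%:R < E' by rewrite /E' -addrA ltrDl addr_gt0// invr_gt0.
have E'1 : 1 <= E'.
  by rewrite /E' addrAC lerDr addr_ge0// invr_ge0 ltW.
have E'0 : 0 < E' by exact: lt_le_trans E'1.
exists (2 * E'); split; first by rewrite mulr_gt0.
move=> p p_prime p3 f g f_norm g_norm.
set lp := ln p%:R; set q := ln lp / lp; set s := q `^ (1 / 3).
have lp3 : ln 3 <= lp by rewrite ler_ln ?posrE ?ltr0n ?ler_nat// prime_gt0.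
have lp1 : 1 < lp by exact: lt_le_trans lp3.
have lp0 : 0 < lp by exact: lt_trans lp1.
have llp3 : ln (ln 3) <= ln lp by rewrite ler_ln ?posrE// (lt_trans _ l3).
have llp0 : 0 < ln lp by exact: lt_le_trans llp3.
have q0 : 0 < q by rewrite divr_gt0.
have s3 : s ^+ 3 = q by rewrite powR_cube// ltW.
have s0 : 0 < s by rewrite powR_gt0.
(* If the claimed bound is at least 1, any [x] works; this settles small [p]. *)
have [big|small] := leP 1 (2 * E' * s).
  by exists 0; apply: le_trans (convolution_centred_le1 p_prime f_norm g_norm 0) big.
have Cs0 : 0 < 2 * E' * s by rewrite !mulr_gt0.
set y := (2 * E' * s)^-1.
have y1 : 1 < y by rewrite invf_gt1.
have y0 : 0 <= y by rewrite ltW// (lt_trans _ y1).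
(* The 2 in the constant pays for rounding [y] up to an integer: [y < n <= 2 y]. *)
pose n := (Num.truncn y).+1.
have n1 : (1 < n)%N by rewrite ltnS truncn_gt0 ltW.
have n0 : 0 < n%:R :> R by rewrite ltr0n.
have yn : y < n%:R by exact: truncnS_gt.
have n2y : n%:R <= 2 * y.
  by have /andP[ty _] := truncn_itv y0; rewrite /n -natr1; lra.
(* Here [(2 y) ^ 3 = 1 / (E' ^ 3 * q)]: the exponent [1 / 3] matches the cube of [n] in the size
   condition. *)
have n3 : n%:R ^+ 3 * (E' * ln lp) <= lp.
  have le1 : n%:R ^+ 3 <= (2 * y) ^+ 3.
    by rewrite lerXn2r ?nnegrE ?mulr_ge0 ?(ltW n0).
  have yE : (2 * y) ^+ 3 = (E' ^+ 3 * q)^-1.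
    by rewrite -s3 /y; field; rewrite !gt_eqF.
  have E'3 : E' <= E' ^+ 3.
    by rewrite exprS ler_peMr ?(ltW E'0)// exprn_ege1.
  have le2 : n%:R ^+ 3 <= lp / (E' * ln lp).
    apply: le_trans le1 _; rewrite yE (_ : lp / _ = (E' * q)^-1); last first.
      by rewrite /q; field; rewrite !gt_eqF.
    have h1 := mulr_gt0 E'0 q0; have h2 := mulr_gt0 (exprn_gt0 3 E'0) q0.
    by rewrite lef_pV2 ?posrE// ler_pM2r.
  by rewrite -ler_pdivlMr// mulr_gt0.
(* With [n3] this yields [n <= n ^ 3 <= lp], so [ln n <= ln lp]. *)
have Ell : 1 <= E' * ln lp.
  have : 1 <= E' * ln (ln 3).
    rewrite /E' mulrDl mulVf ?gt_eqF// lerDr mulr_ge0 ?(ltW ll3)//.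
  by move=> h; apply: le_trans h _; rewrite ler_pM2l.
have ln_n : ln n%:R <= ln lp.
  rewrite ler_ln ?posrE//; apply: le_trans n3.
  apply: (@le_trans _ _ (n%:R ^+ 3)); last by rewrite ler_peMr ?exprn_ge0.
  by rewrite ler_eXnr// ler1n.
have np : (n ^ (E * n ^ 3) < p)%N.
  rewrite -(ltr_nat R) -ltr_ln ?posrE ?ltr0n ?expn_gt0 ?(prime_gt0 p_prime)//.
  rewrite natrX lnXn// -[ln n%:R *+ _]mulr_natl natrM natrX [E%:R * _]mulrC -mulrA.
  apply: lt_le_trans n3.
  apply: (@le_lt_trans _ _ (n%:R ^+ 3 * (E%:R * ln lp))).
    by rewrite !ler_wpM2l ?exprn_ge0.
  by rewrite ltr_pM2l ?exprn_gt0// ltr_pM2r.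
have [x hx] := convolution_small_value p_prime f_norm g_norm (ltnW n1) erefl erefl erefl
  (leq_ltn_trans (EP n _ _ _ n1 erefl erefl erefl) np).
exists x; apply: le_trans hx _.
by rewrite -[leRHS]invrK lef_pV2 ?posrE ?invr_gt0// ltW.
Qed.
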